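(* Let $q$ be a power of a prime $p$ and let $k\geq 1$ be an integer. Let $\mathcal{B}_k=(\mathcal{B}_{k,1},\mathcal{B}_{k,2})$, with $\mathcal{B}_{k,1},\mathcal{B}_{k,2}\in\mathbb{Z}[x,y]$, be the $k$-th bivariate folding polynomial map associated with the Lie algebra $B_2$, i.e. the unique polynomial map satisfying $\mathcal{B}_k(\varPhi(\sigma,\tau))=\varPhi(k\sigma,k\tau)$ for all $\sigma,\tau\in\mathbb{C}$, where $\varPhi=(\varphi_1,\varphi_2)$ is given by \[\varphi_1(\sigma,\tau)=e^{2\pi i\sigma}+e^{-2\pi i\sigma}+e^{2\pi i\tau}+e^{-2\pi i\tau},\] \[\varphi_2(\sigma,\tau)=e^{2\pi i(\sigma+\tau)}+e^{-2\pi i(\sigma+\tau)}+e^{2\pi i(\sigma-\tau)}+e^{2\pi i(\tau-\sigma)}.\] Let $\bar{\mathcal{B}}_k:\mathbb{F}_q^2\to\mathbb{F}_q^2$ be the map induced by reducing the integer coefficients modulo $p$. Set \[a=\frac{q-1}{\gcd(q-1,k)},\quad b=\frac{q+1}{\gcd(q+1,k)},\quad c=\frac{q^2-1}{\gcd(q^2-1,k)},\quad d=\frac{q^2+1}{\gcd(q^2+1,k)}.\] Then \[\left|\bar{\mathcal{B}}_k(\mathbb{F}_q^2)\right|=\frac{(a+b)^2}{8}+\frac{c+d}{4}+\eta(k,q),\] where \[\eta(k,q)=\begin{cases}0 & \text{if } 2\nmid k \text{ or } 2\nmid c,\\ (a+b)/2+1/8 & \text{if } 2\mid k,\ 2\mid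 c \text{ and } 2\mid ab,\\ (a+b)/4+1/4 & \text{if } 2\mid k,\ 2\mid c \text{ and } 2\nmid ab.\end{cases}\]
   Context: The value set of a map $f:\mathbb{F}_q^2\to\mathbb{F}_q^2$ is its image $f(\mathbb{F}_q^2)$. The polynomial maps $\mathcal{B}_k$ (folding polynomials of $B_2$) exist, are unique, and have integer coefficients. *)

(* Defs.v *)
From HB Require Import structures.
From mathcomp Require Import all_boot all_order all_algebra.
From mathcomp Require Import complex.
From mathcomp Require Import reals sequences exp trigo.

Set Implicit Arguments.
Unset Strict Implicit.
Unset Printing Implicit Defensive.

Import Order.TTheory GRing.Theory Num.Theory.

Local Open Scope ring_scope.
Local Open Scope complex_scope.

Definition cexp (R : realType) (z : R[i]) : R[i] :=
  let: x +i* y := z in (expR x)%:C * (cos y +i* sin y).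

Definition cexp2pi (R : realType) (z : R[i]) : R[i] :=
  cexp ((0 +i* (2 * pi)) * z).

Definition Phi (R : realType) (st : R[i] * R[i]) : R[i] * R[i] :=
  let: (s, t) := st in
  (cexp2pi s + cexp2pi (- s) + cexp2pi t + cexp2pi (- t),
   cexp2pi (s + t) + cexp2pi (- (s + t)) + cexp2pi (s - t) + cexp2pi (t - s)).

(* Z[x, y] is {poly {poly int}}, with x the outer variable 'X and y the inner
   variable 'Y = 'X%:P, so that u.[a, b] substitutes a for x and b for y. *)
Definition polymap := ({poly {poly int}} * {poly {poly int}})%type.

(* The map A^2 -> A^2 induced by an integral polynomial map: coefficients are
   sent to A by the canonical morphism intr, which for A of characteristic p is
   reduction modulo p followed by the inclusion of the prime field. *)
Definition induced (A : comNzRingType) (B : polymap) (v : A * A) : A * A :=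
  ((map_poly (map_poly intr) B.1).[v.1, v.2],
   (map_poly (map_poly intr) B.2).[v.1, v.2]).

Definition is_folding_B2 (R : realType) (k : nat) (B : polymap) : Prop :=
  forall s t : R[i],
    induced B (Phi (s, t)) = Phi (k%:R * s, k%:R * t).

Definition gcd_quotient (n k : nat) : nat := (n %/ gcdn n k)%N.

Definition eta (k q : nat) : rat :=
  let a := gcd_quotient (q - 1) k in
  let b := gcd_quotient (q + 1) k in
  let c := gcd_quotient (q ^ 2 - 1) k in
  if ~~ (2 %| k)%N || ~~ (2 %| c)%N then 0
  else if (2 %| a * b)%N then (a%:R + b%:R) / 2 + 1 / 8
  else (a%:R + b%:R) / 4 + 1 / 4.

(* Main.v *)
(* With alpha = u + u^-1 and beta = v + v^-1, where u = e^(2 pi i sigma) and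
   v = e^(2 pi i tau), the map Phi is (alpha + beta, alpha * beta), so the
   folding polynomial acts as the Dickson polynomial D_k on the unordered pair
   {alpha, beta}: u + u^-1 |-> u^k + u^-k.  A point of F_q^2 is an unordered
   pair that is either contained in F_q or of the form {x, x^q} with x in
   F_(q^2).  With V = D_k(F_q) and W = D_k(F_(q^2)), inclusion-exclusion gives
     2 |image| = |V|^2 - |V| + |W| + |W :&: F_q|.
   Writing mu_n for the group of n-th roots of unity, F_q is the image of
   mu_(q-1) :|: mu_(q+1) under u |-> u + u^-1, hence V is that of
   mu_a :|: mu_b; likewise W is that of mu_c :|: mu_d, and W :&: F_q that of
   mu_gcd(c,q-1) :|: mu_gcd(c,q+1).  The last two gcds are (a, b), except that
   they are (2a, 2b) when k and c are both even; this is the origin of eta. *)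
Require Import Defs.
From mathcomp Require Import all_boot all_order all_algebra.
From mathcomp Require Import cyclic falgebra fieldext separable galois finfield.
From mathcomp Require cyclotomic.
From mathcomp Require Import complex.
From mathcomp Require Import reals sequences exp trigo.
From mathcomp Require Import ring lra zify.

Import Order.TTheory GRing.Theory Num.Theory.
Local Open Scope ring_scope.

(** * Folding polynomials and Dickson polynomials *)

(** The Dickson polynomial of the first kind with parameter 1, kept as a function on every
    commutative ring so that it applies alike to field elements and to the variables of Z[x, y]. *)
Fixpoint dickson (A : comNzRingType) (n : nat) (x : A) : A :=
  match n with
  | 0 => 2
  | 1 => x
  | (n'.+1 as m).+1 => x * dickson _ m x - dickson _ n' x
  end.
Arguments dickson {A} n x.

Lemma dicksonSS {A : comNzRingType} n (x : A) :
  dickson n.+2 x = x * dickson n.+1 x - dickson n x.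
Proof. by []. Qed.

Lemma dickson_rmorph {A A' : comNzRingType} (f : {rmorphism A -> A'}) n x :
  f (dickson n x) = dickson n (f x).
Proof.
suff: f (dickson n x) = dickson n (f x) /\
      f (dickson n.+1 x) = dickson n.+1 (f x) by case.
elim: n => [|n [IHn IHn1]]; first by rewrite /= rmorph_nat.
by split=> //; rewrite !dicksonSS rmorphB rmorphM IHn IHn1.
Qed.

Lemma dickson_addV {A : fieldType} n (u : A) : u != 0 ->
  dickson n (u + u^-1) = u ^+ n + (u ^+ n)^-1.
Proof.
move=> u0.
suff: dickson n (u + u^-1) = u ^+ n + (u ^+ n)^-1 /\
      dickson n.+1 (u + u^-1) = u ^+ n.+1 + (u ^+ n.+1)^-1 by case.
elim: n => [|n [IHn IHn1]]; first by rewrite /= expr0 expr1 invr1.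
split=> //; rewrite dicksonSS IHn IHn1 !exprS.
have un0 : u ^+ n != 0 by rewrite expf_neq0.
by field; rewrite u0 un0.
Qed.

Definition sym2 {A : comNzRingType} (v : A * A) : A * A :=
  (v.1 + v.2, v.1 * v.2).

Lemma sym2_rmorph {A A' : comNzRingType} (f : {rmorphism A -> A'}) v :
  sym2 (f v.1, f v.2) = (f (sym2 v).1, f (sym2 v).2).
Proof. by rewrite /sym2 rmorphD rmorphM. Qed.

(** Substitution packaged as a ring morphism, so that [dickson_rmorph], [sym2_rmorph] and
    [induced_rmorph] apply to it. *)
Definition eval2 {A : comNzRingType} (v : A * A) :
    {rmorphism {poly {poly int}} -> A} :=
  (horner_eval v.2 : {rmorphism {poly A} -> A}) \o
  ((horner_eval v.1%:P : {rmorphism {poly {poly A}} -> {poly A}}) \o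
   (map_poly (map_poly (intr : {rmorphism int -> A})) :
     {rmorphism {poly {poly int}} -> {poly {poly A}}})).

(** Integer coefficients are fixed by every ring morphism. This serves to pass from R to R[i], from
    Z[x, y] to any ring, and from F to an extension. *)
Lemma induced_rmorph {A A' : comNzRingType} (f : {rmorphism A -> A'}) B v :
  induced B (f v.1, f v.2) = (f (induced B v).1, f (induced B v).2).
Proof.
suff H P : f (map_poly (map_poly intr) P).[v.1, v.2] =
  (map_poly (map_poly intr) P).[f v.1, f v.2] by rewrite /induced /= !H.
rewrite -horner_map -horner_map /= map_polyC /= -map_poly_comp.
congr ((_.[_]).[_]); apply: eq_map_poly => r /=.
by rewrite -map_poly_comp; apply: eq_map_poly => z /=; rewrite rmorph_int.
Qed.

Lemma poly0_inj_roots {A : idomainType} (f : nat -> A) (P : {poly A}) :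
  injective f -> (forall n, P.[f n] = 0) -> P = 0.
Proof.
move=> fI Pf; apply/eqP; apply/contraT => P0.
have := max_poly_roots P0 (rs := map f (iota 0 (size P))).
rewrite size_map size_iota ltnn map_inj_uniq ?iota_uniq // => -> //.
by apply/allP => _ /mapP[n _ ->]; rewrite /root Pf.
Qed.

(** A nonzero polynomial over a domain has finitely many roots; this is used first in x, with
    polynomials in y as coefficients, then in y. Characteristic zero makes the integers embed in
    [A]. *)
Lemma eval2_eq {A : numDomainType} (f : nat -> A) (P Q : {poly {poly int}}) :
    injective f ->
    (forall m n, eval2 (f m, f n) P = eval2 (f m, f n) Q) ->
  P = Q.
Proof.
move=> fI PQ; apply/eqP; rewrite -subr_eq0; apply/eqP.
have intrI : injective (map_poly (intr : int -> A)).
  by apply: map_inj_poly => //; exact: intr_inj.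
apply: (map_inj_poly intrI (rmorph0 _)); rewrite rmorph0.
apply: (@poly0_inj_roots _ (polyC \o f)) => [m n /polyC_inj/fI //| m].
apply: (@poly0_inj_roots _ f) => // n.
have -> : (map_poly (map_poly intr) (P - Q)).[(polyC \o f) m].[f n] =
  eval2 (f m, f n) (P - Q) by [].
by rewrite rmorphB; apply/eqP; rewrite subr_eq0; apply/eqP; exact: PQ.
Qed.

(** The difference of the two sides factors, so the fibres of u + u^-1 are the orbits of
    inversion. *)
Lemma addV_eq {K : fieldType} (u v : K) : u != 0 -> v != 0 ->
  (u + u^-1 == v + v^-1) = (u == v) || (u == v^-1).
Proof.
move=> u0 v0; rewrite -subr_eq0.
have -> : u + u^-1 - (v + v^-1) = (u - v) * (u - v^-1) / u.
  by field; rewrite u0 v0.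
by rewrite !mulf_eq0 invr_eq0 (negPf u0) orbF !subr_eq0.
Qed.

Section Folding.
Local Open Scope complex_scope.
Context (R : realType).

(* At purely imaginary arguments the exponentials in Phi are real, and they
   still take every positive value. *)
Definition iarg (y : R) : R[i] := 0 +i* (- y / (2 * pi)).

Lemma cexp2pi_iarg y : cexp2pi (iarg y) = (expR y)%:C.
Proof.
rewrite /cexp2pi /iarg.
have -> : (0 +i* (2 * pi)) * (0 +i* (- y / (2 * pi))) = y +i* 0 :> R[i].
  have pi0 : pi != 0 :> R by rewrite gt_eqF // pi_gt0.
  simpc; congr (_ +i* _); rewrite mulrC divfK //.
  by rewrite mulf_neq0 ?pnatr_eq0.
by rewrite /cexp cos0 sin0; simpc.
Qed.

Lemma Phi_iarg (y z : R) (u := expR y) (v := expR z) :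
  Phi (iarg y, iarg z) =
    ((u + u^-1 + (v + v^-1))%:C, ((u + u^-1) * (v + v^-1))%:C).
Proof.
have argN w : - iarg w = iarg (- w) by rewrite /iarg; simpc.
have argD w w' : iarg w + iarg w' = iarg (w + w').
  by rewrite /iarg; simpc; rewrite -opprD -mulrDl.
rewrite /Phi !argN !argD argN !cexp2pi_iarg -!rmorphD !expRN !expRD !expRN.
have u0 : u != 0 by rewrite gt_eqF // expR_gt0.
have v0 : v != 0 by rewrite gt_eqF // expR_gt0.
by congr (_%:C, _%:C); rewrite -/u -/v; [ring|field; rewrite u0 v0].
Qed.

Lemma iarg_mulrn k (y : R) : k%:R * iarg y = iarg (y *+ k).
Proof.
rewrite mulr_natl /iarg -mulNrn (mulrnAl (- y)).
elim: k => [|k IHk]; first by rewrite !mulr0n.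
by rewrite !(mulrS _ k) IHk; simpc.
Qed.

End Folding.

(** The generic point: an identity at [vars2] specializes along [eval2 v] to any point v over any
    commutative ring. *)
Definition vars2 : {poly {poly int}} * {poly {poly int}} := ('X, 'X%:P).

Lemma eval2_X {A : comNzRingType} (v : A * A) : eval2 v vars2.1 = v.1.
Proof. by rewrite /= /horner_eval map_polyX hornerX hornerC. Qed.

Lemma eval2_Y {A : comNzRingType} (v : A * A) : eval2 v vars2.2 = v.2.
Proof.
by rewrite /= /horner_eval map_polyC /= map_polyX hornerC hornerX.
Qed.

(* The identity is one between polynomials over int; it is checked at the
   infinitely many points u + u^-1 with u a positive integer. *)
Lemma folding_sym2 {R : realType} {k B} (A : comNzRingType) (v : A * A) :
  is_folding_B2 R k B ->
  induced B (sym2 v) = sym2 (dickson k v.1, dickson k v.2).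
Proof.
move=> foldB.
pose f (n : nat) : R := n.+1%:R + n.+1%:R^-1.
have fI : injective f.
  move=> m n /eqP; rewrite addV_eq ?pnatr_eq0 // => /orP[|/eqP].
    by rewrite eqr_nat => /eqP[].
  (* If m + 1 is the inverse of n + 1, these two positive integers have product 1, hence are both
     1. *)
  move=> /(congr1 ( *%R^~ n.+1%:R)); rewrite mulVf ?pnatr_eq0 // -natrM.
  move/eqP; rewrite (eqr_nat _ _ 1) muln_eq1 => /andP[/eqP + /eqP].
  by case: m n => [|m] [|n].
have key : induced B (sym2 vars2) = sym2 (dickson k vars2.1, dickson k vars2.2).
  have step m n :
      induced B (sym2 (f m, f n)) = sym2 (dickson k (f m), dickson k (f n)).
    have lnK (l : nat) : expR (ln l.+1%:R) = l.+1%:R :> R.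
      by rewrite lnK // posrE ltr0n.
    (* These arguments give u = m + 1 and v = n + 1; multiplying them by k raises u and v to the
       k-th power. *)
    have := foldB (iarg _ (ln m.+1%:R)) (iarg _ (ln n.+1%:R)).
    rewrite (iarg_mulrn _ k (ln m.+1%:R)) (iarg_mulrn _ k (ln n.+1%:R)).
    rewrite (Phi_iarg _ (ln m.+1%:R)) (Phi_iarg _ (ln m.+1%:R *+ k)).
    rewrite -(mulr_natl (ln m.+1%:R)) -(mulr_natl (ln n.+1%:R)).
    rewrite !expRM_natl !lnK -/(f m) -/(f n).
    have /= -> := induced_rmorph (real_complex R) B (sym2 (f m, f n)).
    move=> [E1 E2]; rewrite /induced /= E1 E2.
    by rewrite /sym2 /= !dickson_addV ?pnatr_eq0.
  have pt m n : (eval2 (f m, f n) (induced B (sym2 vars2)).1,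
      eval2 (f m, f n) (induced B (sym2 vars2)).2) =
      (eval2 (f m, f n) (sym2 (dickson k vars2.1, dickson k vars2.2)).1,
      eval2 (f m, f n) (sym2 (dickson k vars2.1, dickson k vars2.2)).2).
    rewrite -induced_rmorph -!sym2_rmorph !dickson_rmorph !eval2_X !eval2_Y.
    exact: step.
  rewrite [LHS]surjective_pairing [RHS]surjective_pairing; congr (_, _).
    by apply: (eval2_eq f) => // m n; case: (pt m n).
  by apply: (eval2_eq f) => // m n; case: (pt m n).
have -> : v = (eval2 v vars2.1, eval2 v vars2.2).
  by rewrite eval2_X eval2_Y; case: v.
by rewrite sym2_rmorph induced_rmorph key -sym2_rmorph !dickson_rmorph.
Qed.

(** * Roots of unity and the map u + u^-1 *)

(** Weigh x by 2 if [s] fixes it and by 1 otherwise. Each fibre {x, s x} then has total weight 2. *)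
Lemma card_imset_involution {T U : finType} (f : T -> U) (s : T -> T)
    (A : {set T}) :
    {in A, forall x, s x \in A} ->
    {in A &, forall x y, (f x == f y) = (x == y) || (x == s y)} ->
  (#|f @: A| * 2 = #|A| + #|[set x in A | s x == x]|)%N.
Proof.
move=> sA fE; rewrite -sum_nat_const.
have -> : (#|A| + #|[set x in A | s x == x]| =
           \sum_(x in A) (1 + (s x == x)))%N.
  rewrite big_split /= sum1_card -sum1dep_card big_mkcondr /=.
  by congr addn; apply: eq_bigr => x _; case: eqP.
rewrite (partition_big_imset f) /=; apply: eq_bigr => _ /imsetP[x Ax ->].
have [sx|nsx] := eqVneq (s x) x.
  rewrite (big_pred1 x) ?sx ?eqxx // => y /=; case: (boolP (y \in A)) => Ay /=.
    by rewrite fE // sx orbb.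
  by case: eqP Ay => // ->; rewrite Ax.
(* If [s] fixed [s x], the fibre condition at x and [s x] would give x = s x. *)
have nssx : s (s x) != s x.
  apply: contraNneq nsx => ssx.
  have := fE (s x) x (sA _ Ax) Ax; rewrite eqxx orbT eq_sym.
  by rewrite (fE x (s x) Ax (sA _ Ax)) ssx orbb eq_sym.
rewrite (bigD1 x) /= ?Ax ?eqxx // (bigD1 (s x)) /=; last first.
  by rewrite sA // nsx fE ?sA // eqxx orbT.
rewrite (negPf nsx) (negPf nssx) big1 // => y.
case: (boolP (y \in A)) => Ay //=; rewrite fE //.
by case: eqP => //= _; case: eqP.
Qed.

Definition mu {L : finFieldType} (n : nat) : {set L} := [set x | x ^+ n == 1].

(** The order of a common root of unity divides both exponents, hence their gcd. *)
Lemma mu_gcd {L : finFieldType} m n :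
  (0 < m)%N -> mu (gcdn m n) = mu m :&: mu n :> {set L}.
Proof.
move=> m0; apply/setP=> x; rewrite !inE; apply/eqP/andP => [xg|].
  have xgr l : (gcdn m n %| l)%N -> x ^+ l == 1.
    by case/dvdnP=> r ->; rewrite mulnC exprM xg expr1n.
  by rewrite !xgr ?dvdn_gcdl ?dvdn_gcdr.
case=> /eqP xm /eqP xn.
have [o ox om] := prim_order_exists m0 xm.
have on : (o %| n)%N by rewrite (prim_order_dvd ox) xn.
by apply/eqP; rewrite -(prim_order_dvd ox) dvdn_gcd om.
Qed.

Lemma mu_neq0 {L : finFieldType} n (x : L) : (0 < n)%N -> x \in mu n -> x != 0.
Proof.
rewrite inE => n0; apply: contraTneq => ->.
by rewrite expr0n gtn_eqF // eq_sym oner_eq0.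
Qed.

Lemma mu_inv {L : finFieldType} n (x : L) : x \in mu n -> x^-1 \in mu n.
Proof. by rewrite !inE exprVn => /eqP ->; rewrite invr1. Qed.

Lemma mu_dvd {L : finFieldType} m n :
  (m %| n)%N -> mu m \subset (mu n : {set L}).
Proof.
move=> /dvdnP[r ->]; apply/subsetP => x; rewrite !inE mulnC exprM => /eqP ->.
by rewrite expr1n.
Qed.

Section RootsOfUnity.
Context {L : finFieldType} {N : nat} {z : L} (zP : N.-primitive_root z).

Lemma card_mu n : (n %| N)%N -> #|mu n : {set L}| = n.
Proof.
move=> nN; have wP := dvdn_prim_root zP nN; set w := z ^+ _ in wP.
rewrite -[RHS]card_ord.
rewrite -(@card_imset _ _ (fun i : 'I_n => w ^+ i) predT) => [|i j].
  apply: eq_card => x; rewrite inE.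
  apply/eqP/imsetP => [/(prim_rootP wP)[i ->]|[i _ ->]].
    by exists i.
  by rewrite exprAC (prim_expr_order wP) expr1n.
by move/eqP; rewrite (eq_prim_root_expr wP) !modn_small // => /eqP/val_inj.
Qed.

(** [mu n] is cyclic, generated by w; its image is generated by w ^+ k, of order n / gcd(n, k). *)
Lemma imset_exp_mu k n : (n %| N)%N ->
  [set x ^+ k | x in mu n] = mu (n %/ gcdn n k) :> {set L}.
Proof.
move=> nN; have wP := dvdn_prim_root zP nN; set w := z ^+ _ in wP.
have wkP := exp_prim_root wP k; rewrite gcdnC in wkP.
apply/setP=> x; apply/imsetP/idP => [[y /[!inE] /eqP yn ->]|].
  rewrite -exprM muln_divA ?dvdn_gcdl // mulnC -muln_divA ?dvdn_gcdr //.
  by rewrite exprM yn expr1n.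
rewrite inE => /eqP /(prim_rootP wkP)[i ->]; exists (w ^+ i).
  by rewrite inE exprAC (prim_expr_order wP) expr1n.
by rewrite exprAC.
Qed.

Definition addV (x : L) : L := x + x^-1.

(** Count orbits of inversion, whose fixed points are the square roots of 1. For equal parities the
    overlap of the two groups is as large as the fixed set and the two cancel; otherwise the overlap
    is 1 and the fixed set has 2 elements, whence the extra 1. *)
Lemma card_addV_mu m n : (m %| N)%N -> (n %| N)%N -> (gcdn m n %| 2)%N ->
  (#|addV @: (mu m :|: mu n)| * 2 = m + n + (odd m != odd n))%N.
Proof.
move=> mN nN mn2; have N0 := prim_order_gt0 zP.
have [m0 n0] := (dvdn_gt0 N0 mN, dvdn_gt0 N0 nN).
have nz (x : L) : x \in mu m :|: mu n -> x != 0 by case/setUP; exact: mu_neq0.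
have gN d : (d %| N)%N -> (gcdn 2 d %| N)%N.
  by apply: dvdn_trans; exact: dvdn_gcdr.
rewrite (card_imset_involution addV (fun x => x^-1)).
- have -> : [set x in mu m :|: mu n | x^-1 == x] =
      mu (gcdn 2 m) :|: mu (gcdn 2 n) :> {set L}.
    apply/setP => x; rewrite !mu_gcd // -setIUr in_setI [LHS]inE andbC.
    case: (boolP (x \in _ :|: _)) => [/nz x0|]; rewrite ?andbF ?andbT //.
    by rewrite [RHS]inE -(inj_eq (mulfI x0)) divff // eq_sym expr2.
  rewrite !cardsU -!mu_gcd ?gcdn_gt0 // !card_mu ?gN //; last 2 first.
  + by rewrite (dvdn_trans (dvdn_gcdl _ _)) ?gN.
  + by rewrite (dvdn_trans (dvdn_gcdl _ _)).
  have g2 d : gcdn 2 d = (2 - odd d)%N.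
    by rewrite -gcdn_modr modn2; case: odd.
  have -> : gcdn m n = (2 - (odd m || odd n))%N.
    rewrite -(gcdn_idPr mn2) gcdnA g2.
    by case: odd; rewrite ?gcd1n // g2.
  have gg : gcdn (2 - odd m) (2 - odd n) = (2 - (odd m || odd n))%N.
    by case: odd; case: odd.
  by rewrite !g2 gg; move: m0 n0; clear; case: (odd m); case: (odd n); lia.
- by move=> x /setUP[] /mu_inv xm; rewrite inE xm ?orbT.
- by move=> x y /nz x0 /nz y0; exact: addV_eq.
Qed.

End RootsOfUnity.

(** * Arithmetic of the quotients by gcds *)

Lemma dvdn_gcd2 m m' n n' :
  (m %| m')%N -> (n %| n')%N -> (gcdn m n %| gcdn m' n')%N.
Proof.
by move=> mm' nn'; rewrite dvdn_gcd (dvdn_trans (dvdn_gcdl m n) mm')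
  (dvdn_trans (dvdn_gcdr m n) nn').
Qed.

Lemma gcd_quotientK n k : (gcd_quotient n k * gcdn n k)%N = n.
Proof. exact: divnK (dvdn_gcdl n k). Qed.

Lemma gcd_quotient_dvd n k : (gcd_quotient n k %| n)%N.
Proof. by apply/dvdnP; exists (gcdn n k); rewrite mulnC gcd_quotientK. Qed.

(* Both sides times gcdn (n * n') k equal n * gcdn n' k, because
   gcdn n k * gcdn n' k =
   gcdn (n * n') (gcdn (gcdn n n') k * gcdn (n * n') k). *)
Lemma gcdn_gcd_quotientM n n' k (c := gcd_quotient (n * n') k) : (0 < k)%N ->
  gcdn c n = (gcd_quotient n k * gcdn c (gcdn (gcdn n n') k))%N.
Proof.
move=> k0; set g := gcdn (gcdn n n') k.
have G0 : (0 < gcdn (n * n') k)%N by rewrite gcdn_gt0 k0 orbT.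
have cG : (c * gcdn (n * n') k = n * n')%N by exact: gcd_quotientK.
have gG : (gcdn n k * gcdn n' k = gcdn (n * n') (g * gcdn (n * n') k))%N.
  rewrite [in RHS]muln_gcdr [RHS]gcdnA (gcdn_idPl (dvdn_mull g (dvdnn _))).
  by rewrite !muln_gcdl !muln_gcdr !gcdnA (mulnC k n').
apply/eqP; rewrite -(eqn_pmul2r G0) -mulnA !(muln_gcdl c) cG -gG.
rewrite mulnA gcd_quotientK -muln_gcdr gcdnA.
by rewrite (gcdn_idPl (dvdn_mull n (dvdnn n'))).
Qed.

Lemma odd_gcd_quotient n k : odd k -> odd (gcd_quotient n k) = odd n.
Proof.
move=> ok; rewrite -[in RHS](gcd_quotientK n k) oddM.
by rewrite (dvdn_odd (dvdn_gcdr n k) ok) andbT.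
Qed.

Lemma sqrB1 q : (q ^ 2 - 1 = (q - 1) * (q + 1))%N.
Proof. by rewrite -subn_sqr exp1n. Qed.

Lemma gcdn_pred_succ q : (0 < q)%N -> gcdn (q - 1) (q + 1) = gcdn (q - 1) 2.
Proof.
move=> q0; have -> : (q + 1 = q - 1 + 2)%N by lia.
by rewrite gcdnDl.
Qed.

Section Quotients.
Context {q k : nat} (q0 : (0 < q)%N) (k0 : (0 < k)%N).
Local Notation a := (gcd_quotient (q - 1) k).
Local Notation b := (gcd_quotient (q + 1) k).
Local Notation c := (gcd_quotient (q ^ 2 - 1) k).
Local Notation d := (gcd_quotient (q ^ 2 + 1) k).

(** Both orders of the factorization q^2 - 1 = (q - 1)(q + 1) are used. The common extra factor
    divides 2; whether it is 1 or 2 decides whether eta vanishes. *)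
Lemma gcdn_c : gcdn c (q - 1) = (a * gcdn c (gcdn (gcdn (q - 1) 2) k))%N /\
  gcdn c (q + 1) = (b * gcdn c (gcdn (gcdn (q - 1) 2) k))%N.
Proof.
rewrite -gcdn_pred_succ // sqrB1 gcdn_gcd_quotientM //; split=> //.
by rewrite mulnC gcdn_gcd_quotientM // (gcdnC (q + 1)).
Qed.

(** Since 4 never divides q^2 + 1, an even k removes its only possible factor 2. *)
Lemma odd_d : ~~ odd k -> odd d.
Proof.
rewrite -dvdn2 => k2; apply: contraT; rewrite -dvdn2 => d2.
have M2 : (2 %| q ^ 2 + 1)%N := dvdn_trans d2 (gcd_quotient_dvd _ k).
have : (4 %| q ^ 2 + 1)%N.
  by rewrite -(gcd_quotientK (q ^ 2 + 1) k) (@dvdn_mul 2 2) // dvdn_gcd M2.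
rewrite -{1}(odd_double_half q) -mul2n; case: odd; rewrite /dvdn => /eqP; lia.
Qed.

(** The extra factor of [gcdn_c] divides 2, k and c, so it is 1. For odd k the quotients keep the
    parities of q - 1, q + 1, q^2 - 1 and q^2 + 1; for even k, c is odd, a and b divide c, and d is
    odd. *)
Lemma quotients_nondegenerate : odd k || odd c ->
  [/\ odd a = odd b, odd c = odd d, gcdn c (q - 1) = a & gcdn c (q + 1) = b].
Proof.
move=> kc; have [aE bE] := gcdn_c.
have r1 : gcdn c (gcdn (gcdn (q - 1) 2) k) = 1%N.
  set r := gcdn _ _; have r2 : (r %| 2)%N.
    apply: dvdn_trans (dvdn_gcdr _ _) _; apply: dvdn_trans (dvdn_gcdl _ _) _.
    exact: dvdn_gcdr.
  have : odd r.
    case/orP: kc => [ok|]; last exact/dvdn_odd/dvdn_gcdl.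
    by apply: dvdn_odd ok; rewrite (dvdn_trans (dvdn_gcdr _ _)) // dvdn_gcdr.
  by move: (r) (dvdn_leq (ltn0Sn 1) r2) => [|[|[]]].
rewrite r1 !muln1 in aE bE; split=> //.
- have [ok|ek] := boolP (odd k).
    by rewrite !odd_gcd_quotient // oddB // oddD.
  rewrite (negPf ek) /= in kc.
  by rewrite (dvdn_odd _ kc) ?(dvdn_odd _ kc) // -?aE -?bE dvdn_gcdl.
- have [ok|ek] := boolP (odd k).
    by rewrite !odd_gcd_quotient // oddB ?oddD // expn_gt0 q0.
  by rewrite odd_d //; move: kc; rewrite (negPf ek).
Qed.

Lemma quotients_degenerate : ~~ odd k -> ~~ odd c ->
  [/\ odd a || odd b, odd c != odd d, gcdn c (q - 1) = (a * 2)%N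
    & gcdn c (q + 1) = (b * 2)%N].
Proof.
move=> ek ec; have [aE bE] := gcdn_c.
have oq : odd q.
  have : ~~ odd (q ^ 2 - 1).
    by rewrite -dvdn2; apply: dvdn_trans (gcd_quotient_dvd _ k); rewrite dvdn2.
  by rewrite oddB ?expn_gt0 ?q0 // addbT negbK oddX.
have r2 : gcdn c (gcdn (gcdn (q - 1) 2) k) = 2.
  have -> : gcdn (q - 1) 2 = 2 by apply/gcdn_idPr; rewrite dvdn2 oddB // oq.
  have -> : gcdn 2 k = 2 by apply/gcdn_idPl; rewrite dvdn2.
  by apply/gcdn_idPr; rewrite dvdn2.
rewrite r2 in aE bE; split=> //; last by rewrite (negPf ec) odd_d.
(* If a and b were both even, 4 would divide 2a and 2b, hence both q - 1 and q + 1, which differ by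
   2. *)
apply: contraT; rewrite negb_or -!dvdn2 => /andP[/dvdnP[x ax] /dvdnP[y byy]].
have /dvdnP[x'] := dvdn_gcdr c (q - 1); have /dvdnP[y'] := dvdn_gcdr c (q + 1).
rewrite aE bE ax byy; lia.
Qed.

(** This gcd divides 2, and c is even whenever d is. Hence [mu d] adds nothing beyond [mu c] to the
    intersection of W with F_q. *)
Lemma gcdn_d_dvd_c n : (n %| q ^ 2 - 1)%N -> (gcdn d n %| c)%N.
Proof.
move=> nc; have g2 : (gcdn d n %| 2)%N.
  have E2 : (q ^ 2 + 1 - (q ^ 2 - 1) = 2)%N.
    by have := expn_gt0 q 2; rewrite q0; move: (q ^ 2)%N => Q; lia.
  rewrite -[X in (_ %| X)%N]E2 dvdn_sub ?(dvdn_trans (dvdn_gcdr _ _) nc) //.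
  exact: dvdn_trans (dvdn_gcdl _ _) (gcd_quotient_dvd _ _).
have [od|ed] := boolP (odd d).
  have : odd (gcdn d n) := dvdn_odd (dvdn_gcdl _ _) od.
  by move: (gcdn d n) (dvdn_leq (ltn0Sn 1) g2) => [|[|[]]].
apply: dvdn_trans g2 _; rewrite dvdn2.
have ok : odd k by apply: contraNT ed; exact: odd_d.
have [_ -> _ _] // : [/\ odd a = odd b, odd c = odd d, gcdn c (q - 1) = a
  & gcdn c (q + 1) = b] by apply: quotients_nondegenerate; rewrite ok.
Qed.

End Quotients.

(* n is the size of the image, v = |V|, w = |W|, w0 = |W :&: F_q|; trivial_eta
   selects the case eta = 0. *)
Lemma count_arith (n a b c d e1 e2 v w w0 : nat) (trivial_eta : bool) :
  (n * 2 + v = v * v + (w + w0))%N ->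
  (v * 2 = a + b + (odd a != odd b))%N ->
  (w * 2 = c + d + (odd c != odd d))%N ->
  (w0 * 2 = e1 + e2 + (odd e1 != odd e2))%N ->
  (if trivial_eta then [/\ odd a = odd b, odd c = odd d, e1 = a & e2 = b]
   else [/\ odd a || odd b, odd c != odd d, e1 = a * 2 & e2 = b * 2])%N ->
  n%:R = (a%:R + b%:R) ^+ 2 / 8 + (c%:R + d%:R) / 4 +
    (if trivial_eta then 0 else
     if (2 %| a * b)%N then (a%:R + b%:R) / 2 + 1 / 8
     else (a%:R + b%:R) / 4 + 1 / 4) :> rat.
Proof.
move=> nE vE wE w0E.
move/(congr1 (fun m => m%:R : rat)): nE; rewrite !natrD !natrM => nE.
move/(congr1 (fun m => m%:R : rat)): vE; rewrite !natrD !natrM => vE.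
move/(congr1 (fun m => m%:R : rat)): wE; rewrite !natrD !natrM => wE.
move/(congr1 (fun m => m%:R : rat)): w0E; rewrite !natrD !natrM => w0E.
have -> : n%:R = (v%:R * v%:R + (w%:R + w0%:R) - v%:R) / 2 :> rat by lra.
have -> : w%:R = (c%:R + d%:R + (odd c != odd d)%:R) / 2 :> rat by lra.
have -> : w0%:R = (e1%:R + e2%:R + (odd e1 != odd e2)%:R) / 2 :> rat by lra.
have -> : v%:R = (a%:R + b%:R + (odd a != odd b)%:R) / 2 :> rat by lra.
case: trivial_eta => [[ab cd -> ->]|[ab -> -> ->]].
  by rewrite ab cd !eqxx /=; field.
rewrite dvdn2 !oddM !andbF /= !natrM.
by case: (odd a) (odd b) ab => [] [] // _ /=; field.
Qed.

(** * Unordered pairs and conjugate pairs *)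

(** In a splitting field of X^n - 1 this polynomial is separable, so it has n distinct roots, and
    one of them is primitive. *)
Lemma finField_primitive_root_extension (F : finFieldType) n : n%:R != 0 :> F ->
  exists (L : finFieldType) (f : {rmorphism F -> L}) (z : L),
    n.-primitive_root z.
Proof.
move=> nF.
have n0 : (0 < n)%N by case: n nF => //; rewrite eqxx.
have /FinSplittingFieldFor[L [rs]] : 'X^n - 1 != 0 :> {poly F}.
  by rewrite monic_neq0 // monicXnsubC.
rewrite rmorphB rmorph1 /= map_polyXn => rsE _.
have rsP : all n.-unity_root rs.
  apply/allP => x; rewrite -root_prod_XsubC -(eqp_root rsE) => xr.
  by rewrite /root_of_unity.
have rsU : uniq rs.
  rewrite -separable_prod_XsubC -(eqp_separable rsE).
  rewrite cyclotomic.separable_Xn_sub_1 //.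
  by rewrite -(rmorph_nat (in_alg L)) fmorph_eq0.
have sz_rs : (n <= size rs)%N.
  by rewrite -ltnS -(size_prod_XsubC rs id) -(eqp_size rsE) size_XnsubC.
have /hasP[z _ zP] := has_prim_root n0 rsP rsU sz_rs.
by exists (FinFieldExtType L), (in_alg L), z.
Qed.

Lemma dickson_expr_pchar {A : comNzRingType} Q k (x : A) : [pchar A].-nat Q ->
  dickson k (x ^+ Q) = dickson k x ^+ Q.
Proof.
move=> QA.
suff: dickson k (x ^+ Q) = dickson k x ^+ Q /\
      dickson k.+1 (x ^+ Q) = dickson k.+1 x ^+ Q by case.
elim: k => [|k [IHk IHk1]].
  by split=> //=; rewrite -[2]/(1 + 1) exprDn_pchar // expr1n.
split=> //; rewrite !dicksonSS IHk IHk1.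
by rewrite exprDn_pchar // exprNn_pchar // exprMn.
Qed.

(** Equal sums and products make x a root of (X - y)(X - y'); the sum then determines x'. *)
Lemma sym2_eq {K : idomainType} (v w : K * K) :
  (sym2 v == sym2 w) = (v == w) || (v == (w.2, w.1)).
Proof.
case: v w => x x' [y y'] /=; rewrite /sym2 !xpair_eqE /=.
apply/andP/orP => [[/eqP sE /eqP pE]|]; last first.
  by case=> /andP[/eqP-> /eqP->]; rewrite ?eqxx // addrC eqxx mulrC eqxx.
have x'E : x' = y + y' - x by rewrite -sE addrC addKr.
have /eqP : (x - y) * (x - y') = 0.
  have -> : (x - y) * (x - y') = x * x - x * (y + y') + y * y' by ring.
  by rewrite -sE -pE; ring.
rewrite mulf_eq0 !subr_eq0 => /orP[] /eqP xy; [left|right]; rewrite xy eqxx.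
  by rewrite x'E xy addrC addKr eqxx.
by rewrite x'E xy addrK eqxx.
Qed.

(** The copy of F_Q in L, when Q is a power of the characteristic and L contains F_Q; as a plain set
    it needs no subfield structure. *)
Definition powFix {L : finFieldType} (Q : nat) : {set L} :=
  [set x | x ^+ Q == x].

Lemma card_powFix_le {L : finFieldType} Q :
  (1 < Q)%N -> (#|powFix Q : {set L}| <= Q)%N.
Proof.
move=> Q1; pose P : {poly L} := 'X^Q - 'X.
have szP : size P = Q.+1.
  by rewrite size_polyDl size_polyXn // size_polyN size_polyX.
rewrite cardE -ltnS -szP max_poly_roots -?size_poly_eq0 ?szP ?enum_uniq //.
apply/allP => x; rewrite mem_enum inE /root !hornerE => /eqP ->.
by rewrite subrr.
Qed.

Lemma powFix_sqr {L : finFieldType} Q :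
  powFix Q \subset (powFix (Q ^ 2) : {set L}).
Proof.
by apply/subsetP => x; rewrite !inE expnS expn1 exprM => /eqP xQ; rewrite !xQ.
Qed.

Definition unordered_pairs {L : finFieldType} (V : {set L}) : {set L * L} :=
  [set sym2 v | v in setX V V].

(** For x in F_(q^2), the two coordinates are the trace and the norm of x over F_q. *)
Definition conjugate_pairs {L : finFieldType} q (W : {set L}) : {set L * L} :=
  [set sym2 (x, x ^+ q) | x in W].

(** Inclusion-exclusion: swapping the entries and x |-> x^q are the involutions that count the two
    kinds of pairs, and the overlap is the diagonal of V. *)
Lemma card_pairs {L : finFieldType} q (V W : {set L}) :
    V \subset W :&: powFix q -> W \subset powFix (q ^ 2) ->
    (forall x, x \in W -> x ^+ q \in W) ->
  (#|unordered_pairs V :|: conjugate_pairs q W| * 2 + #|V| =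
    #|V| * #|V| + (#|W| + #|W :&: powFix q|))%N.
Proof.
move=> VW Wq2 Wq.
have VP x : x \in V -> x \in W /\ x ^+ q = x.
  by move=> /(subsetP VW) /setIP[xW] /[!inE] /eqP.
have qq x : x \in W -> x ^+ q ^+ q = x.
  by move=> /(subsetP Wq2); rewrite inE -exprM => /eqP.
have cV : (#|unordered_pairs V| * 2 = #|V| * #|V| + #|V|)%N.
  rewrite (card_imset_involution sym2 (fun v => (v.2, v.1))).
  - rewrite cardsX; congr addn.
    have <- : #|[set (x, x) | x in V]| = #|V|.
      by rewrite card_imset // => x y [].
    apply: eq_card => -[x y]; rewrite !inE /= xpair_eqE.
    apply/idP/imsetP => [/andP[/andP[xV _] /andP[/eqP -> _]]|[u uV [-> ->]]].
      by exists x.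
    by rewrite uV eqxx.
  - by move=> [x y]; rewrite !inE /= andbC.
  - by move=> v w _ _; exact: sym2_eq.
have cW : (#|conjugate_pairs q W| * 2 = #|W| + #|W :&: powFix q|)%N.
  rewrite (card_imset_involution (fun x => sym2 (x, x ^+ q)) (fun x => x ^+ q)).
  - by congr addn; apply: eq_card => x; rewrite !inE.
  - exact: Wq.
  - move=> x y xW yW; rewrite sym2_eq /= !xpair_eqE.
    have [->|xy] /= := eqVneq x y; first by rewrite eqxx.
    by have [->|] := eqVneq x (y ^+ q); rewrite // qq ?eqxx.
(* The entries of a pair from V are fixed by the q-th power, so if the pair is also conjugate, they
   are equal. *)
have cI : #|unordered_pairs V :&: conjugate_pairs q W| = #|V|.
  rewrite -(@card_in_imset _ _ (fun x => sym2 (x, x)) V); last first.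
    by move=> x y _ _ /eqP; rewrite sym2_eq /= orbb => /eqP[].
  apply: eq_card => v; rewrite inE; apply/andP/imsetP => [[]|[x xV ->]].
    case/imsetP=> -[x y] /setXP[xV yV] -> /imsetP[u uW /eqP].
    have [_ xq] := VP _ xV; have [_ yq] := VP _ yV.
    rewrite sym2_eq /= !xpair_eqE => /orP[] /andP[/eqP xu /eqP yu].
      by exists x; rewrite // yu -xu xq.
    by exists x; rewrite // xu -yu yq.
  have [xW xq] := VP _ xV; split; apply/imsetP; last by exists x; rewrite ?xq.
  by exists (x, x) => //; rewrite inE xV.
rewrite cardsU cI mulnBl mulnDl cV cW.
(* This makes the truncated subtraction of the overlap exact. *)
have : (#|V| <= #|V| * #|V|)%N by case: #|V| => // l; rewrite leq_pmull.
lia.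
Qed.

Lemma conjugate_pairs_powFix {L : finFieldType} q (W : {set L}) :
    [pchar L].-nat q -> W \subset powFix (q ^ 2) ->
  conjugate_pairs q W \subset setX (powFix q) (powFix q).
Proof.
move=> qL Wq2; apply/subsetP => _ /imsetP[x /(subsetP Wq2) + ->].
rewrite inE expnS expn1 exprM => /eqP xqq.
by rewrite !inE /= exprDn_pchar // exprMn xqq addrC mulrC !eqxx.
Qed.

Lemma unordered_pairs_powFix {L : finFieldType} q (V : {set L}) :
    [pchar L].-nat q -> V \subset powFix q ->
  unordered_pairs V \subset setX (powFix q) (powFix q).
Proof.
move=> qL Vq; apply/subsetP.
move=> _ /imsetP[[x y] /setXP[/(subsetP Vq) + /(subsetP Vq) +] ->].
by rewrite !inE /= exprDn_pchar // exprMn => /eqP -> /eqP ->; rewrite !eqxx.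
Qed.

(** * Finite fields and Dickson images through roots of unity *)

Section Extension.
Context {L : finFieldType} {N : nat} {z : L} (zP : N.-primitive_root z).

(* Surjectivity is by counting: the image has Q elements, and X^Q - X has at
   most Q roots, so no quadratic equation has to be solved in L. *)
Lemma powFix_addV Q :
    [pchar L].-nat Q -> (1 < Q)%N -> (Q - 1 %| N)%N -> (Q + 1 %| N)%N ->
  powFix Q = addV @: (mu (Q - 1) :|: mu (Q + 1)) :> {set L}.
Proof.
move=> QL Q1 N1 N2; apply/esym/eqP; rewrite eqEcard; apply/andP; split.
  apply/subsetP => _ /imsetP[u uP ->].
  have u0 : u != 0 by case/setUP: uP; apply: mu_neq0; rewrite ?subn_gt0 ?addn1.
  rewrite inE exprDn_pchar // exprVn; case/setUP: uP; rewrite inE => /eqP uQ.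
    by rewrite -(subnK (ltnW Q1)) exprD uQ mul1r expr1.
  have -> : u ^+ Q = u^-1 by apply: (mulIf u0); rewrite -exprSr -addn1 uQ mulVf.
  by rewrite invrK addrC.
have Q0 := ltnW Q1.
have g2 : (gcdn (Q - 1) (Q + 1) %| 2)%N by rewrite gcdn_pred_succ // dvdn_gcdr.
have := card_addV_mu zP _ _ N1 N2 g2; rewrite oddB // oddD eqxx addn0.
move=> E; apply: (leq_trans (card_powFix_le _ Q1)); lia.
Qed.

Lemma dickson_addV_mu k n : (0 < n)%N -> (n %| N)%N ->
  [set dickson k x | x in addV @: mu n] =
  addV @: mu (gcd_quotient n k) :> {set L}.
Proof.
move=> n0 nN; rewrite /gcd_quotient -(imset_exp_mu zP k _ nN) -!imset_comp.
by apply: eq_in_imset => u /(mu_neq0 _ _ n0) u0 /=; rewrite /addV dickson_addV.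
Qed.

Lemma dickson_powFix k Q :
    [pchar L].-nat Q -> (1 < Q)%N -> (Q - 1 %| N)%N -> (Q + 1 %| N)%N ->
  [set dickson k x | x in powFix Q] =
  addV @: (mu (gcd_quotient (Q - 1) k) :|: mu (gcd_quotient (Q + 1) k))
    :> {set L}.
Proof.
move=> QL Q1 N1 N2; rewrite powFix_addV // !imsetU !dickson_addV_mu //.
  by rewrite addn1.
by rewrite subn_gt0.
Qed.

End Extension.

(** A common value comes from u in A and w in B with u = w or u = w^-1; closure of B under inversion
    puts u in B. *)
Lemma addV_imsetI {L : finFieldType} (A B : {set L}) :
    {in A, forall u, u != 0} -> {in B, forall u, u != 0} ->
    {in B, forall u, u^-1 \in B} ->
  addV @: A :&: addV @: B = addV @: (A :&: B).
Proof.
move=> A0 B0 BV; apply/setP=> x; rewrite inE.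
apply/andP/imsetP; last by case=> u /setIP[uA uB] ->; rewrite !imset_f.
move=> [/imsetP[u uA ->] /imsetP[w wB /eqP]].
rewrite /addV (addV_eq _ _ (A0 u uA) (B0 w wB)) => uw.
exists u; rewrite // inE uA.
by case/orP: uw => /eqP->; rewrite // BV.
Qed.

(** * Sizes of the value sets *)

Section ValueSets.
Context {L : finFieldType} {z : L} {q k : nat}.
Context (zP : (q ^ 4 - 1)%N.-primitive_root z) (qL : [pchar L].-nat q).
Context (q1 : (1 < q)%N) (k0 : (0 < k)%N).
Local Notation a := (gcd_quotient (q - 1) k).
Local Notation b := (gcd_quotient (q + 1) k).
Local Notation c := (gcd_quotient (q ^ 2 - 1) k).
Local Notation d := (gcd_quotient (q ^ 2 + 1) k).

Lemma q2_gt1 : (1 < q ^ 2)%N.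
Proof. by rewrite -(exp1n 2) ltn_exp2r. Qed.

Lemma q2L : [pchar L].-nat (q ^ 2)%N.
Proof. by rewrite pnatX qL. Qed.

Lemma q4B1 : (q ^ 4 - 1 = (q ^ 2 - 1) * (q ^ 2 + 1))%N.
Proof. by rewrite -sqrB1 -expnM. Qed.

Lemma dvd_q2B1 : (q ^ 2 - 1 %| q ^ 4 - 1)%N.
Proof. by rewrite q4B1 dvdn_mulr. Qed.

Lemma dvd_q2D1 : (q ^ 2 + 1 %| q ^ 4 - 1)%N.
Proof. by rewrite q4B1 dvdn_mull. Qed.

Lemma dvd_qB1 : (q - 1 %| q ^ 2 - 1)%N.
Proof. by rewrite sqrB1 dvdn_mulr. Qed.

Lemma dvd_qD1 : (q + 1 %| q ^ 2 - 1)%N.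
Proof. by rewrite sqrB1 dvdn_mull. Qed.

Let qB1N := dvdn_trans dvd_qB1 dvd_q2B1.
Let qD1N := dvdn_trans dvd_qD1 dvd_q2B1.

Local Notation V := [set dickson k x | x in (powFix q : {set L})].
Local Notation W := [set dickson k x | x in (powFix (q ^ 2) : {set L})].

Lemma card_V : (#|V| * 2 = a + b + (odd a != odd b))%N.
Proof.
rewrite (dickson_powFix zP) // (card_addV_mu zP) //.
- exact: dvdn_trans (gcd_quotient_dvd _ _) qB1N.
- exact: dvdn_trans (gcd_quotient_dvd _ _) qD1N.
apply: (@dvdn_trans (gcdn (q - 1) (q + 1))).
  exact: dvdn_gcd2 (gcd_quotient_dvd _ _) (gcd_quotient_dvd _ _).
by rewrite gcdn_pred_succ ?dvdn_gcdr // ltnW.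
Qed.

Lemma card_W : (#|W| * 2 = c + d + (odd c != odd d))%N.
Proof.
rewrite (dickson_powFix zP) ?q2L ?q2_gt1 ?dvd_q2B1 ?dvd_q2D1 //.
rewrite (card_addV_mu zP) //.
- exact: dvdn_trans (gcd_quotient_dvd _ _) dvd_q2B1.
- exact: dvdn_trans (gcd_quotient_dvd _ _) dvd_q2D1.
apply: (@dvdn_trans (gcdn (q ^ 2 - 1) (q ^ 2 + 1))).
  exact: dvdn_gcd2 (gcd_quotient_dvd _ _) (gcd_quotient_dvd _ _).
by rewrite gcdn_pred_succ ?dvdn_gcdr // ltnW ?q2_gt1.
Qed.

Lemma card_W_powFix (e1 := gcdn c (q - 1)) (e2 := gcdn c (q + 1)) :
  (#|W :&: powFix q| * 2 = e1 + e2 + (odd e1 != odd e2))%N.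
Proof.
have q0 := ltnW q1.
have cN : (c %| q ^ 4 - 1)%N := dvdn_trans (gcd_quotient_dvd _ k) dvd_q2B1.
have e2d : (gcdn e1 e2 %| 2)%N.
  apply: (@dvdn_trans (gcdn (q - 1) (q + 1))).
    exact: dvdn_gcd2 (dvdn_gcdr _ _) (dvdn_gcdr _ _).
  by rewrite gcdn_pred_succ ?dvdn_gcdr.
rewrite -(card_addV_mu zP) // ?(dvdn_trans (dvdn_gcdl _ _)) //.
rewrite (dickson_powFix zP) ?q2L ?q2_gt1 ?dvd_q2B1 ?dvd_q2D1 //.
rewrite (powFix_addV zP) //.
have quot_gt0 n : (0 < n)%N -> (0 < gcd_quotient n k)%N.
  by move=> n0; apply: dvdn_gt0 n0 (gcd_quotient_dvd n k).
have c0 : (0 < c)%N by rewrite quot_gt0 // subn_gt0 q2_gt1.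
have d0 : (0 < d)%N by rewrite quot_gt0 // addn1.
have mB0 : (0 < q - 1)%N by rewrite subn_gt0.
have mD0 : (0 < q + 1)%N by rewrite addn1.
have nz m n : (0 < m)%N -> (0 < n)%N ->
    {in (mu m :|: mu n : {set L}), forall u, u != 0}.
  by move=> m0 n0 u /setUP[]; exact: mu_neq0.
have muV : {in (mu (q - 1) :|: mu (q + 1) : {set L}),
    forall u, u^-1 \in mu (q - 1) :|: mu (q + 1)}.
  by move=> u /setUP[] /mu_inv uV; rewrite inE uV ?orbT.
rewrite (addV_imsetI _ _ (nz _ _ c0 d0) (nz _ _ mB0 mD0) muV).
suff -> : (mu c :|: mu d) :&: (mu (q - 1) :|: mu (q + 1)) =
  mu e1 :|: mu e2 :> {set L} by [].
(* Distributing leaves the parts coming from [mu c] and [mu d]; the latter is absorbed by the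
   former. *)
rewrite !mu_gcd // -setIUr setIUl; apply/setUidPl.
rewrite subsetI subsetIr andbT setIUr subUset -!mu_gcd //.
by rewrite !mu_dvd ?(gcdn_d_dvd_c q0) ?dvd_qB1 ?dvd_qD1.
Qed.

(* Equality by counting again: both sides have q ^ 2 elements. *)
Lemma pairs_powFix :
  unordered_pairs (powFix q) :|: conjugate_pairs q (powFix (q ^ 2)) =
  setX (powFix q) (powFix q) :> {set L * L}.
Proof.
have card_powFix Q : [pchar L].-nat Q -> (1 < Q)%N -> (Q - 1 %| q ^ 4 - 1)%N ->
    (Q + 1 %| q ^ 4 - 1)%N -> #|powFix Q : {set L}| = Q.
  move=> QL Q1 N1 N2; have Q0 := ltnW Q1.
  have g2 : (gcdn (Q - 1) (Q + 1) %| 2)%N by rewrite gcdn_pred_succ ?dvdn_gcdr.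
  have := card_addV_mu zP _ _ N1 N2 g2.
  rewrite -(powFix_addV zP Q QL Q1 N1 N2) oddB // oddD eqxx addn0.
  by move: #|_| Q0 => l; clear; lia.
have cq : #|powFix q : {set L}| = q by exact: card_powFix.
have cq2 : #|powFix (q ^ 2) : {set L}| = (q ^ 2)%N.
  by apply: card_powFix; rewrite ?q2L ?q2_gt1 ?dvd_q2B1 ?dvd_q2D1.
apply/eqP; rewrite eqEcard subUset unordered_pairs_powFix //.
rewrite conjugate_pairs_powFix // cardsX cq /=.
(* With V = F_q and W = F_(q^2), twice the size plus q equals q^2 + (q^2 + q). *)
have := card_pairs q (powFix q : {set L}) (powFix (q ^ 2)).
rewrite (setIidPr (powFix_sqr q)) cq cq2 subxx => /(_ isT (subxx _)).
suff H x : x \in (powFix (q ^ 2) : {set L}) -> x ^+ q \in powFix (q ^ 2).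
  by move=> /(_ H); rewrite -mulnn; move: #|_| => l; clear; lia.
by rewrite !inE exprAC => /eqP ->.
Qed.

(** The map acts as D_k on the entries of both kinds of pairs; conjugate pairs stay conjugate
    because D_k commutes with x |-> x^q. *)
Lemma card_induced_image (R : realType) B : is_folding_B2 R k B ->
  (#|[set induced B v | v in setX (powFix q : {set L}) (powFix q)]| * 2 + #|V| =
    #|V| * #|V| + (#|W| + #|W :&: powFix q|))%N.
Proof.
move=> foldB; rewrite -pairs_powFix imsetU.
have dF := fun x : L => dickson_expr_pchar q k x qL.
have -> : [set induced B v | v in unordered_pairs (powFix q : {set L})] =
    unordered_pairs V.
  rewrite /unordered_pairs -imset_comp; apply/setP => v; apply/imsetP/imsetP.
    case=> -[x y] /setXP[xq yq] -> /=; exists (dickson k x, dickson k y).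
      by apply/setXP; split; exact: imset_f.
    by rewrite (folding_sym2 _ _ foldB).
  case=> -[_ _] /setXP[/imsetP[x xq ->] /imsetP[y yq ->]] ->.
  exists (x, y); first exact/setXP.
  by rewrite /= (folding_sym2 _ _ foldB).
have -> : [set induced B v |
      v in conjugate_pairs q (powFix (q ^ 2) : {set L})] =
    conjugate_pairs q W.
  rewrite /conjugate_pairs -!imset_comp; apply: eq_imset => x /=.
  by rewrite (folding_sym2 _ _ foldB) /= dF.
apply: card_pairs.
- rewrite subsetI imsetS ?powFix_sqr //=.
  by apply/subsetP => _ /imsetP[x /[!inE] /eqP xq ->]; rewrite -dF xq.
- apply/subsetP => _ /imsetP[x /[!inE] /eqP xq ->].
  by rewrite -(dickson_expr_pchar _ _ _ q2L) xq.
- move=> _ /imsetP[x xq ->]; rewrite -dF imset_f //.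
  by move: xq; rewrite !inE exprAC => /eqP ->.
Qed.

End ValueSets.

(** * The count over F_q *)

Theorem theorem2p1 (R : realType) (p m q k : nat) (F : finFieldType)
    (B : polymap) :
  prime p -> (0 < m)%N -> q = (p ^ m)%N -> #|F| = q ->
  (1 <= k)%N ->
  is_folding_B2 R k B ->
  let a := gcd_quotient (q - 1) k in
  let b := gcd_quotient (q + 1) k in
  let c := gcd_quotient (q ^ 2 - 1) k in
  let d := gcd_quotient (q ^ 2 + 1) k in
  #|[set induced B v | v in [set: F * F]]|%:R =
    (a%:R + b%:R) ^+ 2 / 8 + (c%:R + d%:R) / 4 + eta k q :> rat.
Proof.
move=> pP m0 qE Fq k0 foldB a b c d.
have q1 : (1 < q)%N by rewrite qE -(exp1n m) ltn_exp2r // prime_gt1.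
have pF : p \in [pchar F] by apply: card_finPcharP pP; rewrite Fq; exact: qE.
(* This number is -1 in F. Roots of unity of this order include those of orders q - 1, q + 1, q^2 -
   1 and q^2 + 1. *)
have nF : (q ^ 4 - 1)%:R != 0 :> F.
  rewrite natrB ?expn_gt0 ?(ltnW q1) // qE -expnM natrX (pcharf0 pF) expr0n.
  by rewrite gtn_eqF ?muln_gt0 ?m0 // sub0r oppr_eq0 oner_eq0.
have [L [f [z zP]]] := finField_primitive_root_extension F _ nF.
have qL : [pchar L].-nat q.
  by rewrite qE pnatX pnatE // (rmorph_pchar f pF).
pose f2 (v : F * F) := (f v.1, f v.2).
have f2I : injective f2 by move=> [x y] [x' y'] [/fmorph_inj-> /fmorph_inj->].
(* The q elements of the image are roots of X^q - X, which has at most q roots. *)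
have imF : [set f x | x in F] = powFix q.
  apply/eqP; rewrite eqEcard card_imset; last exact: fmorph_inj.
  rewrite Fq card_powFix_le // andbT.
  by apply/subsetP => _ /imsetP[x _ ->]; rewrite inE -rmorphXn -Fq expf_card.
have imB : #|[set induced B v | v in [set: F * F]]| =
    #|[set induced B v | v in setX (powFix q : {set L}) (powFix q)]|.
  rewrite -(card_imset _ f2I) -imset_comp -imF; apply: eq_card => w.
  apply/imsetP/imsetP => [[v _ ->]|].
    exists (f2 v); first by apply/setXP; split; exact: imset_f.
    by rewrite /= /f2 induced_rmorph.
  case=> -[_ _] /setXP[/imsetP[x _ ->] /imsetP[y _ ->]] ->.
  by exists (x, y); rewrite // (induced_rmorph f B (x, y)).
rewrite imB /eta -negb_and.
apply: count_arith.
- exact: (card_induced_image zP qL q1 R B foldB).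
- exact: (card_V zP qL q1).
- exact: (card_W zP qL q1).
- exact: (card_W_powFix zP qL q1 k0).
have q0 := ltnW q1.
rewrite !dvdn2; case: ifP => [|/negbFE/andP[]].
  by rewrite negb_and !negbK; exact: quotients_nondegenerate.
exact: quotients_degenerate.
Qed.
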